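(* Let $F$ be a field of characteristic zero, $f$ an anti-involution of $F^\times$, and $\Phi_f(G)=(G,F^\times,\varphi,f)$ a skew gain graph whose underlying graph $G$ is a tree of order $n$ with matching number $t<\frac{n}{2}$. Then $0$ is an eigenvalue of $A(\Phi_f(G))$ with algebraic multiplicity at least $n-2t$.
   Context: An anti-involution of $F^\times$ is a map $f:F^\times\to F^\times$ with $f(f(x))=x$ and $f(xy)=f(y)f(x)$. A skew gain graph $(G,F^\times,\varphi,f)$ is a simple graph $G$ with vertices $v_1,\dots,v_n$ and a function $\varphi$ on oriented edges (both orientations of each edge) with values in $F^\times$ satisfying $\varphi(\overrightarrow{vu})=f(\varphi(\overrightarrow{uv}))$. Its adjacency matrix $A$ has $(i,j)$ entry $\varphi(\overrightarrow{v_iv_j})$ if $v_i\sim v_j$ and $0$ otherwise. The matching number of $G$ is the maximum number of edges in a matching of $G$. *)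

(* Defs.v *)
From HB Require Import structures.
From mathcomp Require Import all_boot all_order all_algebra.

Set Implicit Arguments.
Unset Strict Implicit.
Unset Printing Implicit Defensive.

Import GRing.Theory.
Local Open Scope ring_scope.

Record sgraph (n : nat) := SGraph {
  adj :> rel 'I_n;
  adj_sym : symmetric adj;
  adj_irrefl : irreflexive adj
}.

Definition edge_set n (G : sgraph n) : {set {set 'I_n}} :=
  [set [set p.1; p.2] | p : 'I_n * 'I_n & G p.1 p.2].

Definition is_matching n (G : sgraph n) (M : {set {set 'I_n}}) : bool :=
  (M \subset edge_set G) && trivIset M.

Definition matching_number n (G : sgraph n) : nat :=
  \max_(M : {set {set 'I_n}} | is_matching G M) #|M|.

Definition connected_graph n (G : sgraph n) : Prop :=
  (0 < n)%N /\ forall u v : 'I_n, connect G u v.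

(* The bound on the length excludes the empty sequence and the closed walks
   u, v, u along a single edge, which [ucycle] accepts. *)
Definition acyclic_graph n (G : sgraph n) : Prop :=
  forall c : seq 'I_n, (2 < size c)%N -> ~ ucycle G c.

Definition is_tree n (G : sgraph n) : Prop :=
  connected_graph G /\ acyclic_graph G.

(* Maps F^x -> F^x are represented by total functions on F that preserve
   nonzero elements; nothing is assumed or used about the value at 0. *)
Record anti_involution (F : fieldType) (f : F -> F) : Prop := AntiInvolution {
  anti_inv_neq0 : forall x, x != 0 -> f x != 0;
  anti_inv_invol : forall x, x != 0 -> f (f x) = x;
  anti_inv_mul : forall x y, x != 0 -> y != 0 -> f (x * y) = f y * f x
}.

(* [gain Phi u v] is the gain of the edge oriented from u to v; its value is
   unconstrained when u and v are not adjacent. *)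
Record skew_gain_graph (F : fieldType) (f : F -> F) (n : nat) :=
  SkewGainGraph {
    ugraph : sgraph n;
    gain : 'I_n -> 'I_n -> F;
    gain_neq0 : forall u v, ugraph u v -> gain u v != 0;
    gain_rev : forall u v, ugraph u v -> gain v u = f (gain u v)
  }.

Definition adjacency_mx (F : fieldType) (f : F -> F) (n : nat)
    (Phi : skew_gain_graph f n) : 'M[F]_n :=
  \matrix_(i, j) (if ugraph Phi i j then gain Phi i j else 0).

Definition alg_mult (F : fieldType) (n : nat) (A : 'M[F]_n) (a : F) : nat :=
  mup a (char_poly A).

(* Main.v *)
(** In the Leibniz expansion of [det (X I - A)], a permutation [s] contributes
    only if every non-fixed point [i] is adjacent to [s i]. In an acyclic graph
    such an [s] has no cycle of length at least 3, so its non-fixed points are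
    covered by a matching and number at most [2t]. The at least [n - 2t] fixed
    points each contribute a factor [X], the diagonal of [A] being zero. *)

Require Import Defs.
From HB Require Import structures.
From mathcomp Require Import all_boot all_order all_algebra.
From mathcomp Require Import perm.

Set Implicit Arguments.
Unset Strict Implicit.
Unset Printing Implicit Defensive.

Import GRing.Theory.
Local Open Scope ring_scope.

(** If [s i] and [s (s i)] both differed from [i], the orbit of [i] would itself be a cycle of [G]
    on at least three vertices. *)
Lemma acyclic_perm_involutive n (G : sgraph n) (s : {perm 'I_n}) :
  acyclic_graph G -> (forall i, s i != i -> G i (s i)) -> involutive s.
Proof.
move=> acG sG i; have inj_s := @perm_inj _ s.
have inj_iter k : injective (iter k s) by elim: k => //= k IHk x y /inj_s/IHk.
have [sii | si_neq] := eqVneq (s i) i; first by rewrite !sii.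
apply/eqP/negPn/negP => ssi_neq.
(* Iterates of [s] are injective, so a fixed point in the orbit would force [s i = i]. Hence every
   step along the orbit is an edge. *)
have si_orbit j : j \in orbit s i -> s j != j.
  move=> /trajectP[k _ ->]; rewrite -iterS iterSr.
  by apply: contra si_neq => /eqP/inj_iter->.
apply: (acG (orbit s i)).
  rewrite size_orbit; have := order_gt0 s i; have := iter_order inj_s i.
  case: (order s i) => [|[|[|k]]] //= e _.
    by rewrite e eqxx in si_neq.
  by rewrite e eqxx in ssi_neq.
rewrite /ucycle orbit_uniq andbT.
apply: (@sub_in_cycle _ [in orbit s i] (frel s)) (cycle_orbit inj_s i).
  by move=> x y /si_orbit sx _ /= /eqP <-; apply: sG.
exact/allP.
Qed.

Lemma acyclic_perm_support n (G : sgraph n) (s : {perm 'I_n}) :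
    acyclic_graph G -> (forall i, s i != i -> G i (s i)) ->
  (#|[set i | s i != i]| <= 2 * matching_number G)%N.
Proof.
move=> acG sG; have sK := acyclic_perm_involutive acG sG.
pose D := [set i | s i != i]; pose M := [set [set i; s i] | i in D].
(* As [s] is an involution, a pair in [M] is determined by either of its points; so distinct pairs
   are disjoint. *)
have edge_of B i : B \in M -> i \in B -> i \in D /\ B = [set i; s i].
  case/imsetP=> j; rewrite inE => sj ->; rewrite !inE.
  by case/orP=> /eqP-> //; rewrite sK setUC eq_sym.
have trivM : trivIset M.
  apply/trivIsetP=> B C MB MC; apply: contraR => /pred0Pn[i /andP[Bi Ci]].
  by rewrite (edge_of _ _ MB Bi).2 (edge_of _ _ MC Ci).2.
have coverM : cover M = D.
  apply/setP=> i; apply/bigcupP/idP => [[B MB Bi] | Di].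
    exact: (edge_of _ _ MB Bi).1.
  by exists [set i; s i]; [apply: imset_f | apply: set21].
have matchM : is_matching G M.
  rewrite /is_matching trivM andbT; apply/subsetP=> _ /imsetP[i Di ->].
  by apply/imsetP; exists (i, s i) => //; rewrite !inE in Di *; apply: sG.
have -> : #|[set i | s i != i]| = (2 * #|M|)%N.
  rewrite -/D -coverM -(eqP trivM) mulnC -sum_nat_const.
  apply: eq_bigr => _ /imsetP[i Di ->].
  by rewrite inE eq_sym in Di; rewrite cards2 Di.
by rewrite leq_mul2l /=; apply: (leq_bigmax_cond M matchM).
Qed.

Lemma dvdXn_char_poly_acyclic (F : fieldType) n (G : sgraph n) (A : 'M[F]_n) :
    acyclic_graph G -> (forall i j, ~~ G i j -> A i j = 0) ->
  'X^(n - 2 * matching_number G) %| char_poly A.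
Proof.
move=> acG A0; rewrite /char_poly /determinant.
(* Divisibility by a fixed power of ['X] passes to sums, so each Leibniz term is treated alone. *)
elim/big_ind: _ => [|p q|s _]; rewrite ?dvdp0 //.
  exact: dvdp_add.
apply: dvdp_mull.
have [sG|] := boolP [forall i, (s i != i) ==> G i (s i)]; last first.
  rewrite negb_forall => /existsP[i]; rewrite negb_imply => /andP[si Gi].
  rewrite (bigD1 i) //= !mxE A0 // eq_sym (negPf si) mulr0n polyC0 subr0.
  by rewrite mul0r dvdp0.
have {}sG i : s i != i -> G i (s i) by move/forallP: sG => /(_ i)/implyP.
(* The factors at fixed points alone supply the power of ['X]; those at moved points form a
   cofactor. *)
rewrite (bigID (fun i => s i == i)) /=; apply: dvdp_mulr.
rewrite (eq_bigr (fun=> 'X)) => [|i /eqP si]; last first.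
  by rewrite !mxE si eqxx mulr1n A0 ?adj_irrefl // polyC0 subr0.
rewrite prodr_const; apply: dvdp_exp2l.
have le_supp := acyclic_perm_support acG sG; rewrite cardsE in le_supp.
have := cardC [pred i | s i == i]; rewrite card_ord leq_subLR => /esym/eq_leq.
by move/leq_trans; apply; rewrite addnC leq_add2r.
Qed.

Theorem theorem3p7 (F : fieldType) (hF : [pchar F] =i pred0)
    (f : F -> F) (hf : anti_involution f)
    (n : nat) (Phi : skew_gain_graph f n)
    (htree : is_tree (ugraph Phi))
    (t : nat) (ht : matching_number (ugraph Phi) = t)
    (htn : (2 * t < n)%N) :
  eigenvalue (adjacency_mx Phi) 0 /\
  (n - 2 * t <= alg_mult (adjacency_mx Phi) 0)%N.
Proof.
set A := adjacency_mx Phi.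
have char_neq0 : char_poly A != 0 by rewrite monic_neq0 ?char_poly_monic.
have mult_ge : (n - 2 * t <= alg_mult A 0)%N.
  rewrite /alg_mult mup_geq // polyC0 subr0 -ht.
  apply: dvdXn_char_poly_acyclic htree.2 _ => i j /negPf Gij.
  by rewrite mxE Gij.
(* Since [2 * t < n], the multiplicity is positive, which makes 0 a root. *)
split=> //; rewrite eigenvalue_root_char -dvdp_XsubCl XsubC_dvd //.
by apply: leq_trans mult_ge; rewrite subn_gt0.
Qed.
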